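(* For any $Y\subseteq J$, the set function $L_Y:2^J\to\mathbb{R}_+$, $$L_Y(X):=\sum_{i\in I}h_i f_{i,Y}(X),\qquad f_{i,Y}(X):=\frac{U_i^L+\sum_{j\in X}w_{ij}}{U_i^L+U_i^F+\sum_{j\in X\cup Y}w_{ij}},$$ is submodular.
   Context: $I$ is a finite nonempty set of customer nodes; $J$ (candidate sites), $J^L$ and $J^F$ (pre-existing facilities of leader and follower) are finite pairwise disjoint sets. Demand weights $h_i\ge 0$ satisfy $\sum_{i\in I}h_i=1$. With real $\alpha_j$, distances $d_{ij}\ge0$ and $\beta>0$, set $w_{ij}:=\exp\{\alpha_j-\beta d_{ij}\}>0$ for $i\in I$, $j\in J\cup J^L\cup J^F$, and $U_i^L:=\sum_{j\in J^L}w_{ij}$, $U_i^F:=\sum_{j\in J^F}w_{ij}$. A function $f:2^J\to\mathbb{R}$ is submodular if $f(S\cup\{j\})-f(S)\ge f(R\cup\{j\})-f(R)$ for all $S\subseteq R\subseteq J$ and all $j\in J\setminus R$. *)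

(* Defs.v *)
From HB Require Import structures.
From mathcomp Require Import all_boot all_order all_algebra.
From mathcomp Require Import reals sequences.

Set Implicit Arguments.
Unset Strict Implicit.
Unset Printing Implicit Defensive.

Import Order.TTheory GRing.Theory Num.Theory.

Local Open Scope ring_scope.

(* Subsets of J are the X : {set T} with X \subset J, in an ambient finite
   type T of sites; the values of f outside the powerset of J are irrelevant. *)
Definition submodular (R : realType) (T : finType) (J : {set T})
    (f : {set T} -> R) : Prop :=
  forall (A B : {set T}) (j : T),
    A \subset B -> B \subset J -> j \in J :\: B ->
    f (B :|: [set j]) - f B <= f (A :|: [set j]) - f A.

Section CustomerChoice.

Variables (R : realType) (I T : finType).
Variables (JL JF : {set T}).
Variables (h : I -> R) (alpha : T -> R) (beta : R) (d : I -> T -> R).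

Definition weight (i : I) (j : T) : R := expR (alpha j - beta * d i j).

(* The existing utilities U_i^L and U_i^F are utility i JL and utility i JF. *)
Definition utility (i : I) (X : {set T}) : R := \sum_(j in X) weight i j.

(* When JL, JF, X and Y are all empty the denominator vanishes, and MathComp's
   convention x / 0 = 0 gives the share 0 (no facility captures the demand). *)
Definition leader_share (i : I) (Y X : {set T}) : R :=
  (utility i JL + utility i X)
    / (utility i JL + utility i JF + utility i (X :|: Y)).

Definition leader_market (Y X : {set T}) : R :=
  \sum_(i : I) h i * leader_share i Y X.

End CustomerChoice.

(* Main.v *)
(* Write the share as N / D with G := D - N the utility not captured by the
   leader. Adding a site j outside Y increases the share by
   w * G / (D * (D + w)), and adding a site of Y increases it by w / D.  As X
   grows, D grows and G shrinks, so both gains decrease; a nonnegative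
   combination of submodular functions is submodular. *)

Require Import Defs.
From HB Require Import structures.
From mathcomp Require Import all_boot all_order all_algebra.
From mathcomp Require Import reals sequences.
From mathcomp Require Import exp ring lra.

Set Implicit Arguments.
Unset Strict Implicit.
Unset Printing Implicit Defensive.

Import Order.TTheory GRing.Theory Num.Theory.

Local Open Scope ring_scope.

(* The case a = l = f = g = 0 has denominator 0: with x / 0 = 0, the gain on
   the right is then 1. *)
Lemma share_gain_le (R : realFieldType) (l f a b g g' w : R) :
  0 <= l -> 0 <= f -> 0 <= a -> a <= b -> 0 < w ->
  a + g <= b + g' -> 0 <= g' -> g' <= g ->
  (l + (w + b)) / (l + f + (w + (b + g'))) - (l + b) / (l + f + (b + g')) <=
  (l + (w + a)) / (l + f + (w + (a + g))) - (l + a) / (l + f + (a + g)).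
Proof.
move=> l_ge0 f_ge0 a_ge0 ab w_gt0 agbg g'_ge0 g'g.
have [D0|D_neq0] := eqVneq (l + f + (a + g)) 0.
  rewrite D0 invr0 mulr0 subr0.
  have -> : l + f + (w + (a + g)) = l + (w + a) by lra.
  rewrite divff; last by rewrite gt_eqF //; lra.
  (* The share subtracted on the left is nonnegative, so it suffices that the other left-hand share
     is at most 1. *)
  rewrite lerBlDr ler_wpDr //; first by rewrite divr_ge0 //; lra.
  by rewrite ler_pdivrMr; lra.
have D_gt0 : 0 < l + f + (a + g) by rewrite lt_neqAle eq_sym D_neq0; lra.
(* Here [f + y] is the utility the leader does not capture. Keeping [x] and [y] generic lets one
   identity rewrite the gains on both sides; positivity of the larger denominator follows from
   [a + g <= b + g']. *)
have gainE (x y : R) : 0 < l + f + (x + y) ->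
    (l + (w + x)) / (l + f + (w + (x + y))) - (l + x) / (l + f + (x + y)) =
    w * (f + y) / ((l + f + (x + y)) * (l + f + (x + y) + w)).
  by move=> D; field; rewrite !gt_eqF //; lra.
rewrite !gainE //; last by lra.
have Dw_gt0 : 0 < (l + f + (a + g)) * (l + f + (a + g) + w).
  by apply: mulr_gt0; lra.
have DD : (l + f + (a + g)) * (l + f + (a + g) + w) <=
          (l + f + (b + g')) * (l + f + (b + g') + w) by apply: ler_pM; lra.
(* Numerators compare through [g' <= g], inverse denominators through [DD]. *)
apply: ler_pM; rewrite ?invr_ge0.
- by apply: mulr_ge0; lra.
- exact: le_trans (ltW Dw_gt0) DD.
- by rewrite ler_pM2l //; lra.
- by rewrite lef_pV2 // posrE (lt_le_trans Dw_gt0).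
Qed.

Section Share.

Variables (R : realType) (I T : finType).
Variables (JL JF : {set T}).
Variables (h : I -> R) (alpha : T -> R) (beta : R) (d : I -> T -> R).

Notation weight := (weight alpha beta d).
Notation utility := (utility alpha beta d).
Notation leader_share := (leader_share JL JF alpha beta d).
Notation leader_market := (leader_market JL JF h alpha beta d).

Lemma weight_gt0 i j : 0 < weight i j.
Proof. exact: expR_gt0. Qed.

Lemma utility_ge0 i X : 0 <= utility i X.
Proof. by apply: sumr_ge0 => j _; exact/ltW/weight_gt0. Qed.

Lemma utility_le i (A B : {set T}) : A \subset B -> utility i A <= utility i B.
Proof.
move=> AB; rewrite [leRHS](big_setID A) /= (setIidPr AB) lerDl.
exact: utility_ge0.
Qed.

Lemma utilityU1 i j (A : {set T}) :
  j \notin A -> utility i (j |: A) = weight i j + utility i A.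
Proof. exact: big_setU1. Qed.

(** Separates the utility that sites of [Y] draw away from the leader: those in [X] count for the
    leader, so only [Y :\: X] remains, and it shrinks as [X] grows. *)
Lemma utilityUD i (X Y : {set T}) :
  utility i (X :|: Y) = utility i X + utility i (Y :\: X).
Proof. by rewrite {1}/utility (big_setID X) /= setUK setDUl setDv set0U. Qed.

Lemma leader_share_ge0 i Y X : 0 <= leader_share i Y X.
Proof. by apply: divr_ge0; rewrite !addr_ge0 ?utility_ge0. Qed.

Lemma leader_share_submodular (J Y : {set T}) i :
  submodular J (leader_share i Y).
Proof.
move=> A B j AB _; rewrite inE => /andP[jNB _].
have jNA : j \notin A by apply: contraNN jNB; exact: subsetP.
rewrite /Defs.leader_share ![_ :|: [set j]]setUC -!setUA.
rewrite !(utilityU1 _ jNB) !(utilityU1 _ jNA).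
have w_gt0 := weight_gt0 i j; set w := weight i j in w_gt0 *.
have L_ge0 := utility_ge0 i JL; have F_ge0 := utility_ge0 i JF.
have A_ge0 := utility_ge0 i A; have AB_le := utility_le i AB.
have AYBY_le := utility_le i (setSU Y AB).
have [jY|jNY] := boolP (j \in Y).
  (* A site already in [Y] leaves the denominator unchanged: each gain is [w] over it. *)
  have jU (X : {set T}) : j |: (X :|: Y) = X :|: Y.
    by apply/setUidPr; rewrite sub1set inE jY orbT.
  (* Since [j] is itself in [A :|: Y], both denominators are at least [w], hence positive, and can
     be inverted. *)
  have w_le : w <= utility i (A :|: Y).
    rewrite /w -[weight i j](big_set1 +%R j (weight i)).
    by apply: utility_le; rewrite sub1set inE jY orbT.
  rewrite !jU -!mulrBl; set D := _ + utility i (B :|: Y).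
  set D' := _ + utility i (A :|: Y).
  have gainE (u v : R) : v + (w + u) - (v + u) = w by ring.
  by rewrite !gainE ler_pM2l // lef_pV2 ?posrE /D /D'; lra.
have jNU (X : {set T}) : j \notin X -> j \notin X :|: Y.
  by rewrite inE (negPf jNY) orbF.
rewrite !(utilityU1 _ (jNU _ jNA)) !(utilityU1 _ (jNU _ jNB)).
(* This matches [share_gain_le] with [a], [b] the utilities of [A], [B] and [g], [g'] those of
   [Y :\: A], [Y :\: B]; [AYBY_le] becomes [a + g <= b + g']. *)
rewrite !utilityUD in AYBY_le *.
have := utility_le i (setDS Y AB); have := utility_ge0 i (Y :\: B).
apply: share_gain_le => //; lra.
Qed.

Lemma leader_market_submodular (J Y : {set T}) :
  (forall i, 0 <= h i) -> submodular J (leader_market Y).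
Proof.
move=> h_ge0 A B j AB BJ jJB; rewrite /Defs.leader_market -!sumrB.
apply: ler_sum => i _; rewrite -!mulrBr ler_wpM2l //.
exact: leader_share_submodular AB BJ jJB.
Qed.

End Share.

Theorem proposition1 (R : realType) (I T : finType)
    (J JL JF : {set T})
    (h : I -> R) (alpha : T -> R) (beta : R) (d : I -> T -> R)
    (I_neq0 : (0 < #|I|)%N)
    (disj_J_JL : [disjoint J & JL])
    (disj_J_JF : [disjoint J & JF])
    (disj_JL_JF : [disjoint JL & JF])
    (h_ge0 : forall i, 0 <= h i)
    (h_sum1 : \sum_(i : I) h i = 1)
    (d_ge0 : forall i j, j \in J :|: JL :|: JF -> 0 <= d i j)
    (beta_gt0 : 0 < beta)
    (Y : {set T}) (YJ : Y \subset J) :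
  (forall X : {set T}, X \subset J ->
     0 <= leader_market JL JF h alpha beta d Y X) /\
  submodular J (leader_market JL JF h alpha beta d Y).
Proof.
split; last exact: leader_market_submodular.
by move=> X _; apply: sumr_ge0 => i _; rewrite mulr_ge0 // leader_share_ge0.
Qed.
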